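(* Let $G=(V,E)$ be a finite simple graph with $n$ vertices in which every vertex has degree at least $1$, let $d_{\min}$ be the minimum vertex degree of $G$, and let $\lambda_n$ be the largest eigenvalue of the normalized Laplacian $L$ of $G$. If $d_{\min}\leq\frac{n-1}{2}$, then $$\lambda_n\geq 1+\frac{1}{\sqrt{d_{\min}(n-1-d_{\min})}}.$$
   Context: A graph $G=(V,E)$ consists of a finite non-empty vertex set $V$ and a symmetric edge relation $E\subset V\times V$ containing no diagonal elements $(v,v)$; write $v\sim w$ for $(v,w)\in E$. The graph is not assumed to be connected. The degree of $v$ is $d(v)=|\{w\in V: w\sim v\}|$, and it is assumed that $d(v)\geq 1$ for all $v\in V$. The normalized Laplacian $L:\mathbb{R}^V\to\mathbb{R}^V$ is given by $$Lf(x)=\frac{1}{d(x)}\sum_{y\sim x}(f(x)-f(y)).$$ It is self-adjoint and positive semidefinite with respect to the inner product $\langle f,g\rangle=\sum_{x\in V} f(x)g(x)d(x)$, and its eigenvalues are written $0=\lambda_1\leq\lambda_2\leq\cdots\leq\lambda_n$, where $n=|V|$. Equivalently, $\lambda_n=\sup_{f\neq 0}\frac{\langle Lf,f\rangle}{\langle f,f\rangle}$. *)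

(* Defs.v *)
From HB Require Import structures.
From mathcomp Require Import all_boot all_order all_algebra.
From mathcomp Require Import polyorder polyrcf.
From mathcomp Require Import reals.

Set Implicit Arguments.
Unset Strict Implicit.
Unset Printing Implicit Defensive.

Import Order.TTheory GRing.Theory Num.Theory.
Local Open Scope ring_scope.

Definition degree (V : finType) (e : rel V) (v : V) : nat :=
  #|[set w | e w v]|.

(* The default #|V| exceeds every degree of a loopless graph, so it never
   affects the minimum when V is nonempty; see min_degreeP. *)
Definition min_degree (V : finType) (e : rel V) : nat :=
  \big[minn/#|V|]_(v : V) degree e v.

Lemma degree_lt (V : finType) (e : rel V) (v : V) :
  irreflexive e -> (degree e v < #|V|)%N.
Proof.
move=> e_irr; rewrite -cardsT; apply: proper_card.
rewrite properT; apply/eqP => /setP/(_ v).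
by rewrite !inE e_irr.
Qed.

Lemma min_degreeP (V : finType) (e : rel V) :
  (0 < #|V|)%N -> irreflexive e ->
  (exists v, degree e v = min_degree e) /\
  (forall v, (min_degree e <= degree e v)%N).
Proof.
move=> /card_gt0P[v0 _] e_irr.
case: (arg_minnP (degree e) (isT : predT v0)) => v _ v_min.
suff -> : min_degree e = degree e v.
  by split=> [|w]; [exists v | exact: v_min].
apply/eqP; rewrite eqn_leq; apply/andP; split.
  have := mem_index_enum v; rewrite /min_degree.
  elim: (index_enum V) => // w s IHs; rewrite big_cons inE geq_min.
  by case: eqVneq => [-> _ | _ /IHs ->]; rewrite ?leqnn ?orbT.
rewrite /min_degree; elim/big_ind: _ => [|x y vx vy|w _].
- exact/ltnW/degree_lt.
- by rewrite leq_min vx vy.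
- exact: v_min.
Qed.

Definition laplacian (R : realType) (V : finType) (e : rel V)
    (f : V -> R) (x : V) : R :=
  (degree e x)%:R^-1 * \sum_(y | e y x) (f x - f y).

(* {ffun V -> R^o} is the library's vector space R^V. *)
Definition laplacian_ffun (R : realType) (V : finType) (e : rel V)
    (f : {ffun V -> R^o}) : {ffun V -> R^o} :=
  [ffun x => laplacian e f x].

Lemma laplacian_linear (R : realType) (V : finType) (e : rel V)
    (a : R) (f g : V -> R) (x : V) :
  laplacian e (fun y => a * f y + g y) x =
    a * laplacian e f x + laplacian e g x.
Proof.
rewrite /laplacian mulrCA -mulrDr; congr (_ * _).
rewrite mulr_sumr -big_split /=; apply: eq_bigr => y _.
by rewrite mulrBr opprD addrACA.
Qed.

Lemma laplacian_ffun_is_linear (R : realType) (V : finType) (e : rel V) :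
  linear (@laplacian_ffun R V e).
Proof.
move=> a f g; apply/ffunP => x; rewrite !ffunE.
rewrite -[RHS](laplacian_linear e a f g x).
by congr (_ * _); apply: eq_bigr => y _; rewrite !ffunE.
Qed.

HB.instance Definition _ (R : realType) (V : finType) (e : rel V) :=
  GRing.isLinear.Build R {ffun V -> R^o} {ffun V -> R^o} *:%R
    (@laplacian_ffun R V e) (@laplacian_ffun_is_linear R V e).

Definition normalized_laplacian (R : realType) (V : finType) (e : rel V) :
    'End({ffun V -> R^o}) :=
  linfun (@laplacian_ffun R V e).

(* Real eigenvalues are all the eigenvalues, since L is self-adjoint for the
   degree-weighted inner product when all degrees are positive.  Existence of
   a largest one is largest_eigenvalue_exists. *)
Definition is_largest_eigenvalue (R : realType) (V : finType) (e : rel V)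
    (lam : R) : Prop :=
  passmx.leigenvalue (normalized_laplacian R e) lam /\
  forall mu : R, passmx.leigenvalue (normalized_laplacian R e) mu -> mu <= lam.

Lemma laplacian_eigenvalueP (R : realType) (V : finType) (e : rel V) (a : R) :
  reflect (exists2 f : {ffun V -> R^o}, f != 0 & laplacian_ffun e f = a *: f)
          (passmx.leigenvalue (normalized_laplacian R e) a).
Proof.
have inE_eig f : (f \in passmx.leigenspace (normalized_laplacian R e) a)
                 = (laplacian_ffun e f == a *: f).
  by rewrite memv_ker add_lfunE opp_lfunE scale_lfunE id_lfunE lfunE subr_eq0.
apply: (iffP idP) => [a_eig | [f f0 Lf]].
  exists (vpick (passmx.leigenspace (normalized_laplacian R e) a)).
    by rewrite vpick0.
  by apply/eqP; rewrite -inE_eig memv_pick.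
apply: contraNneq f0 => eig0.
by rewrite -memv0 -eig0 inE_eig Lf.
Qed.

Lemma largest_eigenvalue_exists (R : realType) (V : finType) (e : rel V) :
  (0 < #|V|)%N -> exists lam : R, is_largest_eigenvalue e lam.
Proof.
move=> /card_gt0P[v0 _].
set L := normalized_laplacian R e.
have L0 : passmx.leigenvalue L 0.
  apply/laplacian_eigenvalueP; exists [ffun => 1].
    by apply/eqP => /ffunP/(_ v0)/eqP; rewrite !ffunE oner_eq0.
  rewrite scale0r; apply/ffunP => x; rewrite !ffunE /laplacian.
  by rewrite big1 ?mulr0 // => y _; rewrite !ffunE subrr.
pose b := vbasis {:{ffun V -> R^o}}.
have b_basis : basis_of {:{ffun V -> R^o}} b by exact: vbasisP.
pose p := char_poly (passmx.mxof b b L).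
have p0 : p != 0 by exact/monic_neq0/char_poly_monic.
have Lp a : passmx.leigenvalue L a = (a \in rootsR p).
  rewrite -(roots_on_rootsR p0) /= -eigenvalue_root_char.
  by rewrite /passmx.leigenvalue (passmx.leigenspaceE b_basis) passmx.vsof_eq0.
exists (\big[Order.max/0]_(a <- rootsR p) a); split.
  rewrite Lp big_seq; elim/big_ind: _ => [|x y px py|//]; first by rewrite -Lp.
  by rewrite /Order.max; case: ifP.
move=> mu; rewrite Lp => mu_p; exact: le_bigmax_seq.
Qed.

(* Main.v *)
Require Import Defs.
From mathcomp Require Import classical_sets.
From mathcomp Require Import all_boot all_order all_algebra.
From mathcomp Require Import reals.
From mathcomp Require Import ring lra zify.

(** Write [d] for the minimum degree, [m = n - 1 - d], [s = sqrt (d * m)], and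
    let [q] be the degree-weighted sum of squares.  Since the Laplacian is
    self-adjoint for the weighted inner product, its Rayleigh quotients are
    bounded by the largest eigenvalue ([rayleigh_le]).  As
    [<Lf,f> = q f - A f], where [A f] sums [f x * f y] over ordered adjacent
    pairs, it is enough to find a nonzero [f] with [s * A f + q f <= 0].

    Pick [v] of degree [d] and let [f] be constant on three layers: [v] itself,
    the set [N] of its neighbours, and the set [W] of the [m] other vertices.
    Only the numbers of ordered adjacent pairs inside [N], from [N] to [W], and
    inside [W] then matter; call them [X], [Y] and [Z].  With [f = s] on [N],
    the value [- s ^ 2] at [v] is the best one, and with [f = - g] on [W] the
    claim becomes (see [layered_form_le0])
    [- d s^2 (s^2 - 1) + X s^2 (s + 1) + Y (s^2 - 2 g s^2 + g^2)
     + Z (s + 1) g^2 <= 0].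
    The left side is nondecreasing in [X] and [Z], which may be replaced by
    their largest values [d (d - 1)] and [m (m - 1)], and affine in [Y], which
    lies between [0] and [d m]; for [m > d] some [g] works at both ends.  For
    [m = d] this is too crude: two cliques of size [d + 1] sharing one vertex
    attain equality.  There the minimum degree forces enough edges between [N]
    and [W], namely [Y + Z >= d m], and [g = 1] works.

    The bound on Rayleigh quotients is obtained without diagonalization.
    Their supremum [mu] makes [mu - L] positive semidefinite.  If [mu] were
    not an eigenvalue, [mu - L] would be injective, hence bounded below by a
    positive multiple of the identity ([psd_injective_coercive]), and [mu]
    could be decreased. *)

Set Implicit Arguments.
Unset Strict Implicit.
Unset Printing Implicit Defensive.

Import Order.TTheory GRing.Theory Num.Theory.
Local Open Scope ring_scope.

(** * Rayleigh quotients of self-adjoint operators *)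

Definition wdot (R : realType) (V : finType) (w : V -> R)
    (f g : {ffun V -> R^o}) : R :=
  \sum_x w x * (f x * g x).

Lemma wdotC (R : realType) (V : finType) (w : V -> R) f g :
  wdot w f g = wdot w g f.
Proof. by apply: eq_bigr => x _; rewrite [f x * _]mulrC. Qed.

Lemma wdotDl (R : realType) (V : finType) (w : V -> R) f g h :
  wdot w (f + g) h = wdot w f h + wdot w g h.
Proof.
by rewrite -big_split; apply: eq_bigr => x _; rewrite !ffunE mulrDl mulrDr.
Qed.

Lemma wdotZl (R : realType) (V : finType) (w : V -> R) a f g :
  wdot w (a *: f) g = a * wdot w f g.
Proof.
rewrite mulr_sumr; apply: eq_bigr => x _.
by rewrite !ffunE /GRing.scale /= -mulrA mulrCA.
Qed.

Lemma wdotDr (R : realType) (V : finType) (w : V -> R) f g h :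
  wdot w h (f + g) = wdot w h f + wdot w h g.
Proof. by rewrite wdotC wdotDl !(wdotC w h). Qed.

Lemma wdotZr (R : realType) (V : finType) (w : V -> R) a f g :
  wdot w g (a *: f) = a * wdot w g f.
Proof. by rewrite wdotC wdotZl wdotC. Qed.

Lemma mulrr_ge0 (R : realDomainType) (a : R) : 0 <= a * a.
Proof. by rewrite -expr2 sqr_ge0. Qed.

Lemma wdot_ge0 (R : realType) (V : finType) (w : V -> R) f :
  (forall x, 0 < w x) -> 0 <= wdot w f f.
Proof.
by move=> w0; apply: sumr_ge0 => x _; rewrite mulr_ge0 ?mulrr_ge0 ?ltW.
Qed.

Lemma wdot_gt0 (R : realType) (V : finType) (w : V -> R)
    (f : {ffun V -> R^o}) :
  (forall x, 0 < w x) -> f != 0 -> 0 < wdot w f f.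
Proof.
move=> w0 f0; rewrite ltNge; apply: contraNN f0 => q0; apply/eqP/ffunP => x.
rewrite ffunE.
have t0 y : 0 <= w y * (f y * f y) by rewrite mulr_ge0 ?mulrr_ge0 ?ltW.
have /eqP : wdot w f f = 0 by apply/eqP; rewrite eq_le q0 sumr_ge0.
rewrite psumr_eq0// => /allP/(_ x (mem_index_enum x)).
by rewrite mulf_eq0 gt_eqF//= mulf_eq0 orbb => /eqP.
Qed.

Lemma sqr_sum_le (R : realFieldType) (V : finType) (a : V -> R) :
  (\sum_x a x) ^+ 2 <= #|V|%:R * \sum_x a x ^+ 2.
Proof.
have dbl : \sum_x \sum_y ((a x ^+ 2 + a y ^+ 2) / 2)
           = #|V|%:R * \sum_x a x ^+ 2.
  under eq_bigr => x _ do rewrite -mulr_suml big_split /= sumr_const.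
  rewrite -mulr_suml big_split /= sumr_const -sumrMnl cardT -cardE.
  rewrite sumrMnl -[#|xpredT|]/#|V| -mulr_natl; lra.
rewrite -dbl expr2 mulr_suml; apply: ler_sum => x _.
rewrite mulr_sumr; apply: ler_sum => y _.
have := sqr_ge0 (a x - a y); rewrite sqrrB mulr2n; nra.
Qed.

(** Expanding [f] in the basis of indicator functions bounds [T f] in terms of
    the images of finitely many vectors. *)
Lemma wdot_bounded (R : realType) (V : finType) (w : V -> R)
    (T : 'End({ffun V -> R^o})) :
  (forall x, 0 < w x) ->
  exists2 K : R, 0 < K & forall f, wdot w (T f) (T f) <= K * wdot w f f.
Proof.
move=> w0; pose d (y : V) : {ffun V -> R^o} := [ffun x => (x == y)%:R].
pose K : R := \sum_y wdot w (T (d y)) (T (d y)) / w y.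
exists (#|V|%:R * K + 1).
  rewrite ltr_wpDl// mulr_ge0 ?ler0n// sumr_ge0// => y _.
  by rewrite mulr_ge0 ?invr_ge0 ?(ltW (w0 y))// wdot_ge0.
move=> f; rewrite mulrDl mul1r ler_wpDr ?wdot_ge0//.
have fE : f = \sum_y f y *: d y.
  apply/ffunP => x; rewrite sum_ffunE (bigD1 x)//= !ffunE eqxx.
  rewrite big1 => [|y /negPf yx]; first by rewrite addr0 [_ *: _]mulr1.
  by rewrite !ffunE eq_sym yx scaler0.
have TfE x : T f x = \sum_y f y * T (d y) x.
  rewrite [in LHS]fE linear_sum sum_ffunE; apply: eq_bigr => y _.
  by rewrite linearZ ffunE.
have -> : wdot w (T f) (T f) = \sum_x w x * (\sum_y f y * T (d y) x) ^+ 2.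
  by apply: eq_bigr => x _; rewrite TfE expr2.
apply: (@le_trans _ _
  (\sum_x w x * (#|V|%:R * \sum_y (f y * T (d y) x) ^+ 2))).
  by apply: ler_sum => x _; rewrite ler_wpM2l ?sqr_sum_le// ltW.
have -> : \sum_x w x * (#|V|%:R * \sum_y (f y * T (d y) x) ^+ 2)
   = #|V|%:R * \sum_y f y ^+ 2 * wdot w (T (d y)) (T (d y)).
  rewrite /wdot; under eq_bigr => x _ do rewrite mulrCA.
  rewrite -mulr_sumr; congr (_ * _).
  under eq_bigr => x _ do rewrite mulr_sumr.
  rewrite exchange_big; apply: eq_bigr => y _.
  rewrite mulr_sumr; apply: eq_bigr => x _; ring.
rewrite -mulrA ler_wpM2l ?ler0n// /K mulr_suml; apply: ler_sum => y _.
rewrite mulrC -mulrA ler_wpM2l ?wdot_ge0//.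
rewrite -[leLHS](mulKf (lt0r_neq0 (w0 y))) ler_wpM2l ?invr_ge0 ?(ltW (w0 y))//.
rewrite /wdot (bigD1 y)//= expr2 ler_wpDr// sumr_ge0// => x _.
by rewrite mulr_ge0 ?mulrr_ge0 ?(ltW (w0 x)).
Qed.

(** Positivity of the form of [B] at [f - t * B f], for a small [t] depending on
    a bound for [B], gives [<Bf,f> >= t * <Bf,Bf>]; a bound for the inverse of
    [B] then compares [<Bf,Bf>] with [<f,f>]. *)
Lemma psd_injective_coercive (R : realType) (V : finType) (w : V -> R)
    (B : 'End({ffun V -> R^o})) :
    (forall x, 0 < w x) ->
    (forall f g, wdot w (B f) g = wdot w f (B g)) ->
    (forall f, 0 <= wdot w (B f) f) -> lker B == 0%VS ->
  exists2 c : R, 0 < c & forall f, c * wdot w f f <= wdot w (B f) f.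
Proof.
move=> w0 Bsym Bpos /lker0_lfunK BK.
have [C C0 BC] := wdot_bounded B w0.
have [K K0 VK] := wdot_bounded (B^-1)%VF w0.
pose t := (C + 1)^-1; have D0 : 0 < C + 1 by lra.
have t0 : 0 < t by rewrite invr_gt0.
exists (t / K); first by rewrite divr_gt0.
move=> f; have := VK (B f); rewrite BK => fK.
have Bge : t * wdot w (B f) (B f) <= wdot w (B f) f.
  have := Bpos (f + (- t) *: B f).
  rewrite linearD linearZ !wdotDl !wdotDr !wdotZl !wdotZr.
  rewrite [wdot w (B (B f)) f]Bsym.
  have : wdot w (B (B f)) (B f) <= (C + 1) * wdot w (B f) (B f).
    have := wdot_ge0 (B (B f) - B f) w0; have := BC (B f).
    rewrite -scaleN1r !wdotDl !wdotDr !wdotZl !wdotZr (wdotC w (B f)).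
    have := wdot_ge0 (B f) w0; nra.
  have tD : t * (C + 1) = 1 by rewrite mulVf ?gt_eqF.
  have := wdot_ge0 (B f) w0.
  move: (wdot w (B f) f) (wdot w (B f) (B f)) (wdot w (B (B f)) (B f)).
  move=> p q r q0 rq h.
  have : t * (t * r) <= t * q.
    by rewrite ler_pM2l// -[q]mul1r -tD -mulrA ler_pM2l.
  lra.
apply: le_trans Bge; rewrite -mulrA ler_pM2l//.
by rewrite ler_pdivrMl.
Qed.

(** The supremum of the Rayleigh quotients is itself an eigenvalue, since
    otherwise coercivity would push it strictly below itself. *)
Lemma rayleigh_le (R : realType) (V : finType) (w : V -> R)
    (L : 'End({ffun V -> R^o})) (lam : R) :
    (forall x, 0 < w x) ->
    (forall f g, wdot w (L f) g = wdot w f (L g)) ->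
    (forall mu, passmx.leigenvalue L mu -> mu <= lam) ->
  forall f, wdot w (L f) f <= lam * wdot w f f.
Proof.
move=> w0 Lsym lamP f0.
have [->|f0n] := eqVneq f0 0.
  by rewrite -(scale0r 0) linearZ !wdotZl !mul0r mulr0.
pose A : set R := [set r | exists2 f : {ffun V -> R^o}, f != 0 &
                      r = wdot w (L f) f / wdot w f f]%classic.
have [K K0 LK] := wdot_bounded L w0.
have A0 : (A !=set0)%classic by exists (wdot w (L f0) f0 / wdot w f0 f0), f0.
have Aub : has_ubound A.
  exists (K + 1) => _ [f fn ->]; rewrite ler_pdivrMr ?wdot_gt0//.
  have := wdot_ge0 (L f - f) w0; have := LK f; have := wdot_ge0 f w0.
  have := wdot_ge0 (L f) w0.
  rewrite -scaleN1r !wdotDl !wdotDr !wdotZl !wdotZr (wdotC w f); nra.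
pose mu := sup A.
have ray f : wdot w (L f) f <= mu * wdot w f f.
  have [->|fn] := eqVneq f 0.
    by rewrite -(scale0r 0) linearZ !wdotZl !mul0r mulr0.
  rewrite -ler_pdivrMr ?wdot_gt0//; by apply: ub_le_sup => //; exists f.
suff mu_lam : mu <= lam.
  by apply: le_trans (ray f0) _; rewrite ler_wpM2r ?wdot_ge0.
apply: lamP; apply/negP => kB.
pose B : 'End({ffun V -> R^o}) := mu *: \1%VF - L.
have BE f : B f = mu *: f + (- 1) *: L f.
  by rewrite add_lfunE opp_lfunE scale_lfunE id_lfunE scaleN1r.
have Bf f : wdot w (B f) f = mu * wdot w f f - wdot w (L f) f.
  by rewrite BE wdotDl !wdotZl mulN1r.
have [|||c c0 cB] := psd_injective_coercive (B := B) w0.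
- by move=> f g; rewrite !BE !(wdotDl, wdotZl, wdotDr, wdotZr) Lsym.
- by move=> f; rewrite Bf subr_ge0.
- move/lker0P: kB => kB; apply/lker0P => f g Bfg; apply: kB; apply: oppr_inj.
  by rewrite -!opp_lfunE opprB.
suff : mu <= mu - c by lra.
apply: ge_sup => // _ [f fn ->]; rewrite ler_pdivrMr ?wdot_gt0//.
have := cB f; rewrite Bf; lra.
Qed.

(** * The inequality between edge counts *)

(** The two conditions on [g] are the inequality at [Y = 0], divided by [s + 1],
    and at [Y = d * m], with [X] and [Z] maximal.  The term
    [d * s ^ 2 * (s + 1) * (s - d)] is minus the sum of the first two summands
    when [X = d * (d - 1)]. *)
Lemma layered_form_of_endpoints (R : realFieldType) (d m s g : R) :
    1 <= d -> 0 < s -> s ^+ 2 = d * m ->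
    m * (m - 1) * g ^+ 2 <= d * s ^+ 2 * (s - d) ->
    m * (m - 1) * (s + 1) * g ^+ 2
      + d * m * (s ^+ 2 - 2 * g * s ^+ 2 + g ^+ 2)
      <= d * s ^+ 2 * (s + 1) * (s - d) ->
  forall X Y Z, X <= d * (d - 1) -> 0 <= Y -> Y <= d * m -> Z <= m * (m - 1) ->
  - d * s ^+ 2 * (s ^+ 2 - 1) + X * s ^+ 2 * (s + 1)
   + Y * (s ^+ 2 - 2 * g * s ^+ 2 + g ^+ 2) + Z * (s + 1) * g ^+ 2 <= 0.
Proof.
move=> d1 s0 s2 E0 E1 X Y Z HX Y0 Ym HZ.
have s1 : 0 < s + 1 by lra.
have hX : X * (s ^+ 2 * (s + 1)) <= d * (d - 1) * (s ^+ 2 * (s + 1)).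
  by rewrite ler_wpM2r// mulr_ge0 ?sqr_ge0 ?ltW.
have hZ : Z * ((s + 1) * g ^+ 2) <= m * (m - 1) * ((s + 1) * g ^+ 2).
  by rewrite ler_wpM2r// mulr_ge0 ?sqr_ge0 ?ltW.
have E0' : m * (m - 1) * (s + 1) * g ^+ 2 <= d * s ^+ 2 * (s + 1) * (s - d).
  have := E0; rewrite -(ler_pM2r s1); lra.
set k := (s ^+ 2 - 2 * g * s ^+ 2 + g ^+ 2) in E1 *.
have hY : Y * k <= Num.max 0 (d * m * k).
  rewrite le_max; have [k0|k0] := leP 0 k.
    by rewrite [X in _ || X]ler_wpM2r ?orbT.
  by rewrite mulr_ge0_le0 // ltW.
move: hY; rewrite le_max => /orP[] hY; lra.
Qed.

(** The weight [g] depends on how far [m] is from [d].  For [m = d] the endpoint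
    [Y = 0] leaves no slack, and the lower bound on [Y + Z] is used with
    [g = 1].  For [2 <= d <= m - 4] the value 0 on [W] is enough.  For [d = 1]
    it just fails at [Y = m], and the small correction [g = 1 / s] repairs this
    as soon as [m >= 3].  In the remaining pairs [m] is slightly above [d], and
    [g = 3 / 5] is large enough to make the coefficient of [Y] negative and
    small enough for the endpoint [Y = 0]. *)
Lemma layered_form_le0 (R : realType) (d m : nat) (s : R) :
    (0 < d)%N -> (d <= m)%N -> 0 < s -> s ^+ 2 = d%:R * m%:R ->
  exists g : R, forall X Y Z : R,
    X <= d%:R * (d%:R - 1) -> 0 <= Y -> Y <= d%:R * m%:R ->
    Z <= m%:R * (m%:R - 1) -> d%:R * m%:R <= Y + Z ->
    - d%:R * s ^+ 2 * (s ^+ 2 - 1) + X * s ^+ 2 * (s + 1)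
     + Y * (s ^+ 2 - 2 * g * s ^+ 2 + g ^+ 2) + Z * (s + 1) * g ^+ 2 <= 0.
Proof.
move=> d0 dm s0 s2.
have d1 : 1 <= d%:R :> R by rewrite ler1n.
case: (ltngtP d m) dm => // [dm|dmE] _; last 1 first.
- rewrite -{m}dmE in s2 *; exists 1 => X Y Z HX Y0 _ HZ YZ.
  have sE : s = d%:R by apply/eqP; rewrite -(@eqrXn2 _ 2) ?ler0n ?ltW// s2 expr2.
  rewrite sE in s0 *; move: d%:R d1 s0 HX HZ YZ => {d0 s2 sE} D D1 D0 HX HZ YZ.
  have hX : X * (D ^+ 2 * (D + 1)) <= D * (D - 1) * (D ^+ 2 * (D + 1)).
    by rewrite ler_wpM2r// mulr_ge0 ?sqr_ge0//; lra.
  have Z1 : Z * (D + 1) <= Y * (D - 1) * (D + 1) by rewrite ler_pM2r; nra.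
  lra.
have m1 : d%:R + 1 <= m%:R :> R by rewrite natr1 ler_nat.
have s_mean : s <= (d%:R + m%:R) / 2.
  rewrite -(@ler_pXn2r _ 2) ?nnegrE ?(ltW s0) ?divr_ge0 ?addr_ge0 ?ler0n// s2.
  have := sqr_ge0 (d%:R - m%:R : R); nra.
have [/andP[d2 m4]|small] := boolP ((2 <= d)%N && (d + 4 <= m)%N).
- exists 0 => X Y Z HX Y0 Ym HZ _.
  have {}d2 : 2 <= d%:R :> R by rewrite ler_nat.
  have {}m4 : d%:R + 4 <= m%:R :> R by rewrite -natrD ler_nat.
  (* (m - 2) ^ 2 >= m * (m - 4) >= d * m *)
  have s_m : s <= m%:R - 2.
    rewrite -(@ler_pXn2r _ 2) ?nnegrE ?(ltW s0)//; last by lra.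
    by rewrite s2; nra.
  have m_le : m%:R <= (s + 1) * (s - d%:R) by nra.
  have sd : 0 <= s - d%:R by nra.
  apply: (@layered_form_of_endpoints R d%:R m%:R s) => //.
    by rewrite expr0n mulr0 !mulr_ge0 ?sqr_ge0//; lra.
  have := ler_wpM2l (mulr_ge0 (ler0n R d) (sqr_ge0 s)) m_le; lra.
have [/andP[/eqP dE m3]|small1] := boolP ((d == 1)%N && (3 <= m)%N).
- exists s^-1 => X Y Z HX Y0 Ym HZ _; rewrite dE in s2 s_mean HX Ym *.
  have {}m3 : 3 <= m%:R :> R by rewrite ler_nat.
  rewrite mul1r in s2; rewrite -s2 in m3 s_mean.
  have V2 : s ^+ 2 * s^-1 ^+ 2 = 1 by rewrite -exprMn mulfV ?gt_eqF ?expr1n.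
  apply: (@layered_form_of_endpoints R 1 m%:R s) => //; rewrite ?mul1r// -s2.
    rewrite mulrAC V2 mul1r; nra.
  have -> : s ^+ 2 * (s ^+ 2 - 1) * (s + 1) * s^-1 ^+ 2
     + s ^+ 2 * (s ^+ 2 - 2 * s^-1 * s ^+ 2 + s^-1 ^+ 2)
     = s ^+ 2 * (s + 1) * (s - 1) - s * (s - 1) ^+ 2.
    by field; rewrite gt_eqF.
  by rewrite gerDl oppr_le0 mulr_ge0 ?sqr_ge0// ltW.
exists (3 / 5) => X Y Z HX Y0 Ym HZ _.
(* Only d = 1, m = 2 and 2 <= d < m <= d + 3 are left. *)
have key : 18 * (m%:R + 3 * d%:R) <= 100 * d%:R ^+ 2 :> R.
  rewrite -natrX -!natrM -natrD -natrM ler_nat; nia.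
(* Multiplying by s + d turns s - d into d * (m - d), which is free of s. *)
have sd : 9 * (m%:R - 1) <= 25 * d%:R ^+ 2 * (s - d%:R).
  rewrite -(@ler_pM2r _ (s + d%:R)); last by lra.
  have -> : 25 * d%:R ^+ 2 * (s - d%:R) * (s + d%:R)
     = 25 * d%:R ^+ 2 * (d%:R * (m%:R - d%:R)).
    rewrite -mulrA; congr (_ * _).
    have : (s - d%:R) * (s + d%:R) = s ^+ 2 - d%:R ^+ 2 by ring.
    rewrite s2 => ->; ring.
  have mk : m%:R - 1 <= d%:R * (m%:R - d%:R) :> R by nra.
  have h1 : 9 * (s + d%:R) <= 25 * d%:R ^+ 2 by lra.
  have h2 : 0 <= 9 * (s + d%:R) by lra.
  have h3 : 0 <= d%:R * (m%:R - d%:R) :> R by lra.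
  have := ler_wpM2r h2 mk; have := ler_wpM2l h3 h1; lra.
have E0 : m%:R * (m%:R - 1) * (3 / 5) ^+ 2
          <= d%:R * s ^+ 2 * (s - d%:R) :> R.
  by rewrite s2; have := ler_wpM2l (ler0n R m) sd; lra.
apply: (@layered_form_of_endpoints R d%:R m%:R s) => //.
have s1 : 0 <= s + 1 by lra.
have := ler_wpM2r s1 E0.
have : 0 <= d%:R * m%:R * (s ^+ 2 / 5 - 9 / 25) :> R.
  by rewrite s2 mulr_ge0 ?mulr_ge0 ?ler0n//; nra.
lra.
Qed.

(** * The Laplacian as a sum over adjacent pairs *)

Lemma laplacian_wdot (R : realType) (V : finType) (e : rel V)
    (f g : {ffun V -> R^o}) :
  (forall v, (0 < degree e v)%N) ->
  wdot (fun x => (degree e x)%:R) (normalized_laplacian R e f) g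
    = \sum_x \sum_(y | e y x) (f x - f y) * g x.
Proof.
move=> deg0; apply: eq_bigr => x _; rewrite lfunE !ffunE /laplacian -mulrA.
by rewrite mulVKf ?pnatr_eq0 -?lt0n ?deg0// mulr_suml.
Qed.

Lemma degree_wdot (R : realType) (V : finType) (e : rel V)
    (f g : {ffun V -> R^o}) :
  wdot (fun x => (degree e x)%:R) f g = \sum_x \sum_(y | e y x) f x * g x.
Proof.
by apply: eq_bigr => x _; rewrite sumr_const /degree cardsE mulr_natl.
Qed.

Lemma laplacian_selfadjoint (R : realType) (V : finType) (e : rel V)
    (f g : {ffun V -> R^o}) :
  symmetric e -> (forall v, (0 < degree e v)%N) ->
  wdot (fun x => (degree e x)%:R) (normalized_laplacian R e f) g
    = wdot (fun x => (degree e x)%:R) f (normalized_laplacian R e g).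
Proof.
move=> e_sym deg0.
rewrite [RHS]wdotC !laplacian_wdot//.
have cross (h k : {ffun V -> R^o}) : \sum_x \sum_(y | e y x) (h x - h y) * k x
    = \sum_x \sum_(y | e y x) h x * k x - \sum_x \sum_(y | e y x) h y * k x.
  rewrite -sumrB; apply: eq_bigr => x _; rewrite -sumrB.
  by apply: eq_bigr => y _; rewrite mulrBl.
rewrite !cross; congr (_ - _).
  by apply: eq_bigr => x _; apply: eq_bigr => y _; rewrite mulrC.
rewrite (exchange_big_dep predT)//=; apply: eq_bigr => x _.
by apply: eq_big => [y|y _]; rewrite 1?e_sym // mulrC.
Qed.

(** * Test functions constant on the three layers around a vertex *)

(** Pairs are ordered, so an edge with both ends in [A :&: B] counts twice. *)
Definition edge_count (R : realType) (V : finType) (e : rel V)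
    (A B : {set V}) : R :=
  \sum_(x in A) \sum_(y in B) (e y x)%:R.

Lemma edge_countC (R : realType) (V : finType) (e : rel V) (A B : {set V}) :
  symmetric e -> edge_count R e A B = edge_count R e B A.
Proof.
move=> e_sym; rewrite /edge_count exchange_big.
by apply: eq_bigr => x _; apply: eq_bigr => y _; rewrite e_sym.
Qed.

Lemma edge_count_ge0 (R : realType) (V : finType) (e : rel V) (A B : {set V}) :
  0 <= edge_count R e A B.
Proof. by do 2!apply: sumr_ge0 => ? _; exact: ler0n. Qed.

Lemma edge_count_le (R : realType) (V : finType) (e : rel V) (A B : {set V}) :
  edge_count R e A B <= #|A|%:R * #|B|%:R.
Proof.
rewrite mulr_natl -sumr_const; apply: ler_sum => x _.
by rewrite -sumr_const; apply: ler_sum => y _; rewrite lern1 leq_b1.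
Qed.

Lemma edge_count_diag_le (R : realType) (V : finType) (e : rel V)
    (A : {set V}) :
  irreflexive e -> edge_count R e A A <= #|A|%:R * (#|A|%:R - 1).
Proof.
move=> e_irr; rewrite mulr_natl -sumr_const; apply: ler_sum => x xA.
rewrite (bigD1 x)//= e_irr add0r -sumr_const [X in _ <= X - _](bigD1 x)//=.
by rewrite [leRHS]addrC addKr; apply: ler_sum => y _; rewrite lern1 leq_b1.
Qed.

Definition far (V : finType) (e : rel V) (v : V) : {set V} :=
  [set y | (y != v) && ~~ e y v].

Lemma sum_layers (R : realType) (V : finType) (e : rel V) (v : V)
    (F : V -> R) : irreflexive e ->
  \sum_x F x = F v + \sum_(x in [set y | e y v]) F x + \sum_(x in far e v) F x.
Proof.
move=> e_irr; rewrite (bigD1 v)//= -addrA (bigID (fun x => e x v))/=.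
congr (_ + (_ + _)); apply: eq_bigl => x; rewrite !inE//.
by case: eqVneq => // ->; rewrite e_irr.
Qed.

Definition layered (R : realType) (V : finType) (e : rel V) (v : V)
    (a b c : R) : {ffun V -> R^o} :=
  [ffun x => if x == v then a else if e x v then b else c].

Lemma layered_sum (R : realType) (V : finType) (e : rel V) (v : V)
    (a b c : R) (phi : R -> R -> R) :
  symmetric e -> irreflexive e ->
  let f := layered e v a b c in
  let N := [set y | e y v] in let W := far e v in
  \sum_x \sum_(y | e y x) phi (f x) (f y) =
    (degree e v)%:R * (phi a b + phi b a)
    + edge_count R e N N * phi b b + edge_count R e N W * phi b c
    + edge_count R e W N * phi c b + edge_count R e W W * phi c c.
Proof.
move=> e_sym e_irr f N W.
have fv : f v = a by rewrite ffunE eqxx.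
have fN x : x \in N -> f x = b.
  by rewrite inE ffunE; case: eqVneq => [->|_ ->//]; rewrite e_irr.
have fW x : x \in W -> f x = c.
  by rewrite inE ffunE => /andP[/negPf-> /negPf->].
have vN x : x \in N -> e v x by rewrite inE e_sym.
have vW x : x \in W -> e v x = false by rewrite inE e_sym => /andP[_ /negPf].
have inner x : \sum_(y | e y x) phi (f x) (f y) =
    (e v x)%:R * phi (f x) a + (\sum_(y in N) (e y x)%:R) * phi (f x) b
    + (\sum_(y in W) (e y x)%:R) * phi (f x) c.
  rewrite big_mkcond (sum_layers v _ e_irr) -/N -/W fv !mulr_suml.
  congr (_ + _ + _); first by case: (e v x); rewrite ?mul1r ?mul0r.
    apply: eq_bigr => y yN; rewrite (fN y)//.
    by case: (e y x); rewrite ?mul1r ?mul0r.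
  apply: eq_bigr => y yW; rewrite (fW y)//.
  by case: (e y x); rewrite ?mul1r ?mul0r.
under eq_bigr => x _ do rewrite inner.
rewrite (sum_layers v _ e_irr) -/N -/W fv e_irr mul0r add0r.
have -> : \sum_(y in N) (e y v)%:R = (degree e v)%:R :> R.
  rewrite /degree -/N -sumr_const; apply: eq_bigr => y.
  by rewrite inE => ->.
have -> : \sum_(y in W) (e y v)%:R = 0 :> R.
  by apply: big1 => y /vW; rewrite e_sym => ->.
have -> : \sum_(x in N) ((e v x)%:R * phi (f x) a
      + (\sum_(y in N) (e y x)%:R) * phi (f x) b
      + (\sum_(y in W) (e y x)%:R) * phi (f x) c)
    = (degree e v)%:R * phi b a + edge_count R e N N * phi b b
      + edge_count R e N W * phi b c.
  rewrite /degree -/N -sumr_const !mulr_suml -!big_split; apply: eq_bigr => x xN.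
  by rewrite vN// fN.
have -> : \sum_(x in W) ((e v x)%:R * phi (f x) a
      + (\sum_(y in N) (e y x)%:R) * phi (f x) b
      + (\sum_(y in W) (e y x)%:R) * phi (f x) c)
    = edge_count R e W N * phi c b + edge_count R e W W * phi c c.
  rewrite !mulr_suml -big_split; apply: eq_bigr => x xW.
  by rewrite vW// fW// mul0r add0r.
ring.
Qed.

Lemma card_far (V : finType) (e : rel V) (v : V) :
  irreflexive e -> #|far e v| = (#|V| - 1 - degree e v)%N.
Proof.
move=> e_irr; rewrite /degree.
have -> : far e v = ~: (v |: [set w | e w v]).
  by apply/setP => x; rewrite !inE negb_or.
by rewrite cardsCs setCK cardsU1 inE e_irr subnDA.
Qed.

Lemma far_degree_le (R : realType) (V : finType) (e : rel V) (v : V)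
    (k : nat) :
  symmetric e -> irreflexive e -> (forall x, (k <= degree e x)%N) ->
  k%:R * #|far e v|%:R
    <= edge_count R e (far e v) [set y | e y v]
       + edge_count R e (far e v) (far e v).
Proof.
move=> e_sym e_irr k_le; rewrite mulr_natr -sumr_const -big_split.
apply: ler_sum => x; rewrite inE e_sym => /andP[_ /negPf vx].
have : \sum_y (e y x)%:R = (degree e x)%:R :> R.
  rewrite /degree cardsE -sumr_const [RHS]big_mkcond; apply: eq_bigr => y _.
  by rewrite unfold_in; case: (e y x).
rewrite (sum_layers v _ e_irr) vx add0r => degE.
by rewrite /= degE ler_nat.
Qed.

Theorem theorem4p1 (R : realType) (V : finType) (e : rel V)
    (V_nonempty : (0 < #|V|)%N)
    (e_sym : symmetric e) (e_irr : irreflexive e)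
    (deg_ge1 : forall v : V, (1 <= degree e v)%N)
    (lambda_n : R) (lambda_nP : is_largest_eigenvalue e lambda_n)
    (dmin_le : (min_degree e)%:R <= (#|V|%:R - 1) / 2 :> R) :
  1 + 1 / Num.sqrt ((min_degree e)%:R * (#|V|%:R - 1 - (min_degree e)%:R))
    <= lambda_n.
Proof.
have [[v dv] dmin] := min_degreeP V_nonempty e_irr.
set d := min_degree e in dv dmin dmin_le *.
have d_gt0 : (0 < d)%N by rewrite -dv.
have dV : (d < #|V|)%N by rewrite -dv degree_lt.
pose m := (#|V| - 1 - d)%N.
have mE : #|V|%:R - 1 - d%:R = m%:R :> R.
  by rewrite /m !natrB// subn1 -ltnS prednK.
have dm : (d <= m)%N by rewrite -(ler_nat R) -mE; lra.
rewrite mE; set s := Num.sqrt _.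
have s2 : s ^+ 2 = d%:R * m%:R by rewrite sqr_sqrtr// mulr_ge0 ?ler0n.
have s0 : 0 < s.
  by rewrite sqrtr_gt0 mulr_gt0 ?ltr0n// (leq_trans d_gt0 dm).
have [g gP] := layered_form_le0 d_gt0 dm s0 s2.
have mW : #|far e v| = m by rewrite card_far// dv.
set w := fun x => (degree e x)%:R : R.
have w0 x : 0 < w x by rewrite ltr0n.
have Lsym (f h : {ffun V -> R^o}) :
    wdot w (normalized_laplacian R e f) h
    = wdot w f (normalized_laplacian R e h) by exact: laplacian_selfadjoint.
pose f := layered e v (- s ^+ 2) s (- g).
have Rf := rayleigh_le w0 Lsym lambda_nP.2 f.
have f0 : 0 < wdot w f f.
  apply: wdot_gt0 => //; apply/eqP => /ffunP/(_ v); rewrite !ffunE eqxx.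
  by apply/eqP; rewrite oppr_eq0 gt_eqF ?exprn_gt0.
(* With values - s ^ 2, s, - g and s ^ 2 = d * m, this sum is the left side of
   the inequality that defines g. *)
have Q : \sum_x \sum_(y | e y x) (s * (f y * f x) + f x * f x) <= 0.
  rewrite (layered_sum v _ _ _ (fun p q => s * (q * p) + p * p))//.
  rewrite dv (edge_countC R (far e v))//.
  set X := edge_count _ _ _ _; set Y := edge_count _ _ _ _.
  set Z := edge_count _ _ _ _.
  have cN : #|[set y | e y v]| = d by rewrite -dv.
  have := gP X Y Z.
  have -> : X <= d%:R * (d%:R - 1) by rewrite -cN; exact: edge_count_diag_le.
  have -> : 0 <= Y by exact: edge_count_ge0.
  have -> : Y <= d%:R * m%:R by rewrite -cN -mW; exact: edge_count_le.
  have -> : Z <= m%:R * (m%:R - 1) by rewrite -mW; exact: edge_count_diag_le.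
  have -> : d%:R * m%:R <= Y + Z.
    by rewrite -mW /Y edge_countC//; exact: far_degree_le.
  move=> /(_ isT isT isT isT isT); congr (_ <= 0); ring.
have LE : wdot w (normalized_laplacian R e f) f = wdot w f f
    - \sum_x \sum_(y | e y x) f y * f x.
  rewrite laplacian_wdot// degree_wdot -sumrB; apply: eq_bigr => x _.
  by rewrite -sumrB; apply: eq_bigr => y _; rewrite mulrBl.
have QE : \sum_x \sum_(y | e y x) (s * (f y * f x) + f x * f x)
    = s * (\sum_x \sum_(y | e y x) f y * f x) + wdot w f f.
  rewrite degree_wdot mulr_sumr -big_split; apply: eq_bigr => x _ /=.
  by rewrite mulr_sumr -big_split.
rewrite LE in Rf; rewrite QE in Q.
rewrite div1r -lerBrDl -(ler_pM2r f0) ler_pdivrMl//.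
have := ler_wpM2l (ltW s0) Rf; lra.
Qed.
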